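(* Let $V,H$ be Hilbert spaces over $\mathbb{K}=\mathbb{R}$ or $\mathbb{C}$, let $j:V\to H$ be a bounded linear operator with dense range, and let $a:V\times V\to\mathbb{K}$ be a continuous sesquilinear form such that: if $u\in\ker j$ and $a(u,v)=0$ for all $v\in\ker j$, then $u=0$. Let $A$ be the operator on $H$ associated with $(a,j)$, and for $\lambda\in\mathbb{K}$ let $a_\lambda(u,v)=a(u,v)-\lambda\langle j(u),j(v)\rangle_H$. Assume that $a$ is accretive and that $a_\lambda$ is essentially coercive for some $\lambda\in\mathbb{K}$. Then $A$ is m-accretive.
   Context: The operator $A$ associated with $(a,j)$ is the (well-defined, single-valued) operator on $H$ with graph $\{(x,f)\in H\times H:\exists u\in V,\ j(u)=x \text{ and } a(u,v)=\langle f,j(v)\rangle_H \text{ for all } v\in V\}$. The form $a$ is accretive if $\operatorname{Re} a(u,u)\ge 0$ for all $u\in V$. A continuous sesquilinear form $b:V\times V\to\mathbb{K}$ is essentially coercive if, for every sequence $(u_n)$ in $V$, $u_n\rightharpoonup 0$ weakly in $V$ and $b(u_n,u_n)\to 0$ imply $\|u_n\|_V\to 0$. An operator $A$ on $H$ is accretive if $\operatorname{Re}\langle Au,u\rangle_H\ge 0$ for all $u\in D(A)$, and m-accretive if it is accretive and $\mathrm{Id}+A:D(A)\to H$ is surjective. *)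

(* Defs.v *)
From HB Require Import structures.
From mathcomp Require Import all_boot all_order all_algebra.
From mathcomp Require Import complex.
From mathcomp Require Import all_classical all_reals all_analysis.

Set Implicit Arguments.
Unset Strict Implicit.
Unset Printing Implicit Defensive.

Import Order.TTheory GRing.Theory Num.Theory.
Import numFieldNormedType.Exports.

Local Open Scope classical_set_scope.
Local Open Scope ring_scope.
Local Open Scope complex_scope.

(* The scalar field is either R or R[i]; keeping the choice as data lets one
   statement cover both cases. *)
Variant scalar_kind := RealScalars | ComplexScalars.

Definition scalar_field (R : realType) (k : scalar_kind) : numFieldType :=
  match k with
  | RealScalars => R
  | ComplexScalars => R[i]
  end.

Definition conj_scalar (R : realType) (k : scalar_kind) :
    scalar_field R k -> scalar_field R k :=
  match k with
  | RealScalars => fun x : R => x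
  | ComplexScalars => fun z : R[i] => z^*%C
  end.

Definition re_scalar (R : realType) (k : scalar_kind) : scalar_field R k -> R :=
  match k with
  | RealScalars => fun x : R => x
  | ComplexScalars => fun z : R[i] => complex.Re z
  end.

Arguments conj_scalar {R k}.
Arguments re_scalar {R k}.

Section conj_instances.
Variables (R : realType) (k : scalar_kind).

Let conj_zmod_morphism : zmod_morphism (@conj_scalar R k).
Proof. by case: k => //= x y; rewrite rmorphB. Qed.

Let conj_monoid_morphism : monoid_morphism (@conj_scalar R k).
Proof.
by case: k => //=; split => [|x y]; [rewrite rmorph1|rewrite rmorphM].
Qed.

Let conj_involutive : involutive (@conj_scalar R k).
Proof. by case: k => //=; exact: conjcK. Qed.

HB.instance Definition _ :=
  GRing.isZmodMorphism.Build _ _ (@conj_scalar R k) conj_zmod_morphism.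
HB.instance Definition _ :=
  GRing.isMonoidMorphism.Build _ _ (@conj_scalar R k) conj_monoid_morphism.
HB.instance Definition _ :=
  isInvolutive.Build _ (@conj_scalar R k) conj_involutive.

End conj_instances.

(* The norm of a completeNormedModType (scalar_field R k) takes values in
   scalar_field R k. *)
HB.mixin Record CompleteNormedModule_isHilbert (R : realType)
    (k : scalar_kind) V of CompleteNormedModule (scalar_field R k) V := {
  inner : V -> V -> scalar_field R k ;
  inner_linear : forall (w : V) (c : scalar_field R k) (u v : V),
    inner (c *: u + v) w = c * inner u w + inner v w ;
  inner_conj : forall u v : V, inner u v = conj_scalar (inner v u) ;
  innerxx : forall u : V, inner u u = `|u| ^+ 2
}.

#[short(type="hilbertType")]
HB.structure Definition Hilbert (R : realType) (k : scalar_kind) :=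
  {V of CompleteNormedModule (scalar_field R k) V &
        CompleteNormedModule_isHilbert R k V}.

Section inner_instances.
Variables (R : realType) (k : scalar_kind) (V : hilbertType R k).
Local Notation inner := (@inner R k V).

Let inner_bilinear :
  bilinear_for (GRing.Scale.Law.clone _ _ *%R _)
    (GRing.Scale.Law.clone _ _ (@conj_scalar R k \; *%R) _) inner.
Proof.
split => [w c u v|w c u v] /=; first exact: inner_linear.
by rewrite 3!(inner_conj w) inner_linear rmorphD rmorphM.
Qed.

HB.instance Definition _ :=
  bilinear_isBilinear.Build _ _ _ _ _ _ inner inner_bilinear.

Let inner_hermitian (u v : V) :
  inner u v = (-1) ^+ false * conj_scalar (inner v u).
Proof. by rewrite mul1r -inner_conj. Qed.

HB.instance Definition _ :=
  isHermitianSesquilinear.Build _ _ false conj_scalar inner inner_hermitian.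

Let inner_gt0 (u : V) : u != 0 -> 0 < inner u u.
Proof. by move=> u0; rewrite innerxx exprn_gt0 // normr_gt0. Qed.

HB.instance Definition _ := isDotProduct.Build _ _ inner inner_gt0.

End inner_instances.

Notation sesquilinear_form R k V :=
  {bilinear V -> V -> scalar_field R k | *%R & (@conj_scalar R k \; *%R)}.

Section forms.
Variables (R : realType) (k : scalar_kind).
Local Notation K := (scalar_field R k).
Variables (V H : hilbertType R k).

Definition bounded_operator (j : V -> H) :=
  exists M : K, forall u, `|j u| <= M * `|u|.

Definition continuous_form (b : V -> V -> K) :=
  continuous (fun p : V * V => b p.1 p.2 : K^o).

Definition accretive_form (b : V -> V -> K) := forall u, 0 <= re_scalar (b u u).

Definition weakly_cvg (u : nat -> V) (l : V) :=
  forall phi : {linear V -> K^o}, continuous phi ->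
    phi (u n) @[n --> \oo] --> phi l.

Definition essentially_coercive (b : V -> V -> K) :=
  forall u : nat -> V, weakly_cvg u 0 ->
    (b (u n) (u n) : K^o) @[n --> \oo] --> (0 : K^o) ->
    (`|u n| : K^o) @[n --> \oo] --> (0 : K^o).

Definition shifted_form (b : V -> V -> K) (j : V -> H) (lambda : K) :
    V -> V -> K :=
  fun u v => b u v - lambda * inner (j u) (j v).

End forms.

(* Only the values of the underlying function on dom are meaningful. *)
Record operator (R : realType) (k : scalar_kind) (H : hilbertType R k) :=
  Operator {
  dom : set H ;
  app :> H -> H ;
  dom0 : dom 0 ;
  dom_linear : forall (c : scalar_field R k) x y,
    dom x -> dom y -> dom (c *: x + y) ;
  app_linear : forall (c : scalar_field R k) x y,
    dom x -> dom y -> app (c *: x + y) = c *: app x + app y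
}.

Section operators.
Variables (R : realType) (k : scalar_kind) (H : hilbertType R k).

Definition graph (A : operator H) : set (H * H) :=
  [set p | dom A p.1 /\ A p.1 = p.2].

Definition accretive (A : operator H) :=
  forall x, dom A x -> 0 <= re_scalar (inner (A x) x).

Definition m_accretive (A : operator H) :=
  accretive A /\ forall f : H, exists2 x, dom A x & x + A x = f.

End operators.

Section association.
Variables (R : realType) (k : scalar_kind) (V H : hilbertType R k).
Local Notation K := (scalar_field R k).

Definition associated_graph (a : V -> V -> K) (j : V -> H) : set (H * H) :=
  [set p | exists u, j u = p.1 /\ forall v, a u v = inner p.2 (j v)].

Definition is_associated_operator (a : V -> V -> K) (j : V -> H)
    (A : operator H) :=
  graph A = associated_graph a j.

Definition nondegenerate_on_kernel (a : V -> V -> K) (j : V -> H) :=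
  forall u, j u = 0 -> (forall v, j v = 0 -> a u v = 0) -> u = 0.

(* With graph_inj, associated_operator_exists shows that under its two
   hypotheses the associated operator is well defined: it exists, and its domain
   and its values there are unique. *)
Lemma graph_inj (A B : operator H) : graph A = graph B ->
  dom A = dom B /\ {in dom A, A =1 B}.
Proof.
move=> AB.
have key x : dom A x -> dom B x /\ A x = B x.
  move=> Ax; have : graph A (x, A x) by split.
  by rewrite AB => -[/= ? ->].
split; last by move=> x; rewrite inE => /key[].
apply/seteqP; split=> x; first by case/key.
move=> Bx; have : graph B (x, B x) by split.
by rewrite -AB => -[].
Qed.

Lemma inner_dense_eq0 (j : V -> H) (f : H) :
  dense (range j) -> (forall v, inner f (j v) = 0) -> f = 0.
Proof.
move=> jd fj; apply/eqP/negPn/negP => f0.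
have nf : 0 < `|f| by rewrite normr_gt0.
have [||_ [/= /[swap] -[v _ <-]]] := jd (ball f `|f|).
- by exists f; exact: ballxx.
- exact: ball_open.
rewrite -ball_normE /= => lt.
have : `|f - j v| ^+ 2 = `|f| ^+ 2 + `|j v| ^+ 2.
  rewrite -!innerxx linearBl !linearBr /= fj subr0 [inner (j v) f]inner_conj.
  by rewrite fj rmorph0 sub0r opprK.
move=> e; have : `|f - j v| ^+ 2 < `|f| ^+ 2.
  by rewrite ltr_pXn2r // nnegrE.
by rewrite e gtrDl le_gtF // exprn_ge0.
Qed.

Lemma associated_operator_exists (a : sesquilinear_form R k V)
    (j : {linear V -> H}) :
  dense (range j) -> nondegenerate_on_kernel a j ->
  exists A : operator H, is_associated_operator a j A.
Proof.
move=> jd nd; pose G := associated_graph a j.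
have Glin (c : K) x y f g : G (x, f) -> G (y, g) ->
    G (c *: x + y, c *: f + g).
  move=> [u [/= ju au]] [v [/= jv av]]; exists (c *: u + v); split => /=.
    by rewrite linearP ju jv.
  by move=> w; rewrite !linearPl /= au av.
have G0 f : G (0, f) -> f = 0.
  move=> [u [/= ju au]].
  have u0 : u = 0.
    by apply: nd => // v jv; rewrite au jv linear0r.
  by apply: (inner_dense_eq0 jd) => v; rewrite -au u0 linear0l.
have Gfun x f g : G (x, f) -> G (x, g) -> f = g.
  move=> Gf Gg; apply/eqP; rewrite -subr_eq0; apply/eqP/G0.
  have := Glin (-1) _ _ _ _ Gg Gf.
  by rewrite !scaleN1r addNr addrC.
pose D := [set x | exists f, G (x, f)].
pose F x := xget 0 [set f | G (x, f)].
have GF x : D x -> G (x, F x).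
  by move=> [f Gf]; exact: (@xgetI _ 0 [set f | G (x, f)] f).
have D0 : D 0.
  exists 0, 0; split => /=; first by rewrite linear0.
  by move=> v; rewrite !linear0l.
have DP (c : K) x y : D x -> D y -> D (c *: x + y).
  by move=> [f Gf] [g Gg]; exists (c *: f + g); exact: Glin.
have FP (c : K) x y : D x -> D y -> F (c *: x + y) = c *: F x + F y.
  move=> Dx Dy; apply: (Gfun (c *: x + y)); first exact/GF/DP.
  by apply: Glin; exact: GF.
exists (Operator D0 DP FP); apply/seteqP; split => -[x f] /=.
  by rewrite /graph /= => -[Dx <-]; exact: GF.
move=> Gf; have Dx : D x by exists f.
by split => //=; exact: (Gfun x _ _ (GF x Dx) Gf).
Qed.

End association.

(* Main.v *)
(* Put b(u, v) = a(u, v) + <j u, j v>; one has to solve b(u, .) = <f, j .>.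
   Accretivity of a gives |j u|^2 <= |b(u, u)|, so b is again accretive and
   essentially coercive, and it is injective by nondegeneracy of a on ker j.
   Write b(u, v) = <B u, v>. An injective accretive form is also injective in
   its second argument, so B has dense range and so does its adjoint B*. If B
   were not bounded below, there would be unit vectors u_n with B u_n -> 0;
   then <u_n, B* v> -> 0 for all v, so u_n converges weakly to 0 while
   b(u_n, u_n) -> 0, contradicting essential coercivity. Hence the range of B is
   closed, thus everything. *)
From HB Require Import structures.
Require Import Defs.
From mathcomp Require Import all_boot all_order all_algebra.
From mathcomp Require Import complex ring.
From mathcomp Require Import all_classical all_reals all_analysis.

Set Implicit Arguments.
Unset Strict Implicit.
Unset Printing Implicit Defensive.

Import Order.TTheory GRing.Theory Num.Theory.
Import numFieldNormedType.Exports.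

Local Open Scope classical_set_scope.
Local Open Scope ring_scope.

(** * Smallness from bounds [C * e] *)

Section small_multiples.
Variables (F : numFieldType) (C : F).
Hypothesis C0 : 0 <= C.

Let C1 : 0 < C + 1. Proof. by rewrite ltr_wpDl. Qed.

(** Dividing by [C + 1] instead of [C] covers the case [C = 0]. *)
Let le_eps e : 0 < e -> C * (e / (C + 1)) <= e.
Proof.
by move=> e0; rewrite mulrCA ler_piMr ?(ltW e0)// ler_pdivrMr// mul1r lerDl.
Qed.

Lemma eq0_norm_le_eps (z : F) : (forall e, 0 < e -> `|z| <= C * e) -> z = 0.
Proof.
move=> zC; apply/eqP; rewrite -normr_le0; apply/ler_addgt0Pr => e e0.
by rewrite add0r (le_trans (zC _ (divr_gt0 e0 C1)))// le_eps.
Qed.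

Lemma cvg0_norm_le_eps (f : nat -> F) :
  (forall e, 0 < e -> \forall n \near \oo, `|f n| <= C * e) ->
  (f n : F^o) @[n --> \oo] --> (0 : F^o).
Proof.
move=> fC; apply/cvgr0Pnorm_le => e e0.
have := fC _ (divr_gt0 e0 C1); apply: filterS => n /le_trans; apply.
exact: le_eps.
Qed.

End small_multiples.

(** * Real and complex scalars treated together *)

Section scalars.
Variables (R : realType) (k : scalar_kind).
Local Notation K := (scalar_field R k).
Implicit Types x y z : K.

Lemma mul_conj_scalar z : z * conj_scalar z = `|z| ^+ 2.
Proof.
case: k z => /= z; last by rewrite sqr_normc.
by rewrite real_normK ?num_real.
Qed.

Lemma norm_conj_scalar z : `|conj_scalar z| = `|z|.
Proof.
apply/eqP; rewrite -(@eqrXn2 _ 2)//; apply/eqP.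
by rewrite -!mul_conj_scalar rmorphK mulrC.
Qed.

Lemma re_scalarD x y : re_scalar (x + y) = re_scalar x + re_scalar y.
Proof. by case: k x y => //= -[? ?] [? ?]. Qed.

(** The order on complex scalars is partial; this moves comparisons of real elements to [R], where
    infima exist. *)
Lemma ler_re_scalar x y : x \is Num.real -> y \is Num.real ->
  (re_scalar x <= re_scalar y) = (x <= y).
Proof.
case: k x y => //= x y /complex_realP[r ->] /complex_realP[s ->].
by rewrite lecR.
Qed.

Lemma re_scalar_ge0 x : x \is Num.real -> (0 <= re_scalar x) = (0 <= x).
Proof.
by move=> xr; rewrite -(ler_re_scalar (real0 K) xr); congr (_ <= _); case: k.
Qed.

Lemma re_scalar_gt0 x : 0 < x -> 0 < re_scalar x.
Proof. by case: k x => //= -[r s]; rewrite ltcE => /andP[]. Qed.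

Lemma re_scalar_le_norm z : re_scalar z <= re_scalar `|z|.
Proof.
case: k z => /= z; first exact: ler_norm.
by rewrite (le_trans (ler_norm _))// -lecR; exact: normc_ge_Re.
Qed.

Lemma near_natSinv_lt x : 0 < x -> \forall n \near \oo, n.+1%:R^-1 < x.
Proof.
case: k x => /= x x0; first exact: (near_infty_natSinv_lt (PosNum x0)).
case: x x0 => r s; rewrite ltcE /= => /andP[/eqP -> r0].
near=> n.
have : n.+1%:R^-1 < r by near: n; exact: (near_infty_natSinv_lt (PosNum r0)).
by rewrite -ltcR fmorphV rmorph_nat.
Unshelve. all: by end_near. Qed.

End scalars.

(** * Projections and Riesz representation in a Hilbert space *)

Section hilbert_space.
Variables (R : realType) (k : scalar_kind) (V : hilbertType R k).
Local Notation K := (scalar_field R k).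
Implicit Types u v w x y : V.

Lemma innerBl u v w : inner (u - v) w = inner u w - inner v w.
Proof. exact: linearBl. Qed.

Lemma innerBr u v w : inner w (u - v) = inner w u - inner w v.
Proof. exact: linearBr. Qed.

Lemma innerZl (c : K) u v : inner (c *: u) v = c * inner u v.
Proof. exact: linearZl_LR. Qed.

Lemma innerZr (c : K) u v : inner u (c *: v) = conj_scalar c * inner u v.
Proof. exact: linearZr_LR. Qed.

(** Pythagoras for the projection of [u] onto the line of [v]. Positivity of the left side yields
    Cauchy-Schwarz; the size of the drop yields approximate orthogonality. *)
Lemma sqr_norm_sub_proj u v : v != 0 ->
  `|u - (inner u v / `|v| ^+ 2) *: v| ^+ 2 =
  `|u| ^+ 2 - `|inner u v| ^+ 2 / `|v| ^+ 2.
Proof.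
move=> v0; have s0 : `|v| ^+ 2 != 0 by rewrite expf_neq0// normr_eq0.
have cs : conj_scalar (`|v| ^+ 2) = `|v| ^+ 2 by rewrite -innerxx -inner_conj.
rewrite -innerxx innerBl !innerBr !innerZl !innerZr.
rewrite rmorphM/= fmorphV/= cs -inner_conj !innerxx.
rewrite -mul_conj_scalar -inner_conj.
have alg (F : fieldType) (a p q s : F) : s != 0 ->
    a - q / s * p - (p / s * q - p / s * (q / s * s)) = a - p * q / s.
  by move=> ?; field.
exact: alg.
Qed.

Lemma cauchy_schwarz u v : `|inner u v| <= `|u| * `|v|.
Proof.
have [->|v0] := eqVneq v 0; first by rewrite linear0r normr0 normr0 mulr0.
have nv : 0 < `|v| by rewrite normr_gt0.
rewrite -(@ler_pXn2r _ 2) ?nnegrE ?mulr_ge0// exprMn.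
by rewrite -ler_pdivrMr ?exprn_gt0// -subr_ge0 -sqr_norm_sub_proj// exprn_ge0.
Qed.

Lemma cvg_of_natSinv_dist (C : K) (u : nat -> V) : 0 <= C ->
  (forall m n, `|u m - u n| <= C * (m.+1%:R^-1 + n.+1%:R^-1)) ->
  exists l : V, u @ \oo --> l.
Proof.
move=> C0 uC; suff /cvg_ex[l ul] : cvg (u @ \oo) by exists l.
apply/cauchy_cvgP/cauchy_exP => e e0.
(* The factor 2 comes from [1 / (m + 1) + 1 / (n + 1) <= 2 / (n + 1)] for [n <= m]. *)
have C2 : 0 < (C + 1) * 2 by rewrite mulr_gt0// ltr_wpDl.
have [n _ /(_ n (leqnn n)) ne] := near_natSinv_lt (divr_gt0 e0 C2).
exists (u n), n => // m /= nm; rewrite -ball_normE /=.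
apply: (le_lt_trans (uC _ _)).
apply: (@le_lt_trans _ _ ((C + 1) * 2 * n.+1%:R^-1)).
  rewrite -mulrA; apply: ler_pM => //.
  - by rewrite lerDl.
  - by rewrite mulrDl mul1r lerD2l lef_pV2 ?posrE// ler_nat.
by rewrite mulrC -ltr_pdivlMr.
Qed.

(** Norms are [K]-valued, so the infimum of the squared distances is taken over their real parts in
    [R]. It may not be attained, whence the error [e]. *)
Lemma approx_nearest (M : set V) x (e : K) : M !=set0 -> 0 < e ->
  exists2 m, M m & forall y, M y -> `|x - m| ^+ 2 <= `|x - y| ^+ 2 + e.
Proof.
move=> [m0 Mm0] e0.
pose S := [set re_scalar (`|x - m| ^+ 2) | m in M].
have S_ge0 : lbound S 0.
  by move=> _ [m _ <-]; rewrite re_scalar_ge0 ?ger0_real// exprn_ge0.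
have Sinf : has_inf S.
  by split; [exists (re_scalar (`|x - m0| ^+ 2)), m0 | exists 0].
have [_ [m Mm <-] mlt] := inf_adherent (re_scalar_gt0 e0) Sinf.
exists m => // y My.
rewrite -ler_re_scalar ?ger0_real ?exprn_ge0 ?addr_ge0 ?exprn_ge0 ?(ltW e0)//.
rewrite re_scalarD (le_trans (ltW mlt))// lerD2r.
by apply: ge_inf; [case: Sinf | exists y].
Qed.

Definition vector_subspace (M : set V) :=
  M 0 /\ forall (c : K) x y, M x -> M y -> M (c *: x + y).

(** Compare [m] with [m + t *: y], where [t *: y] is the projection of [x - m] onto the line of [y]:
    the squared distance drops by [|inner (x - m) y|^2 / |y|^2], hence by at most [e ^+ 2]. *)
Lemma approx_nearest_orthogonal (M : set V) x m (e : K) :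
  vector_subspace M -> M m ->
  0 <= e -> (forall y, M y -> `|x - m| ^+ 2 <= `|x - y| ^+ 2 + e ^+ 2) ->
  forall y, M y -> `|inner (x - m) y| <= e * `|y|.
Proof.
move=> [_ MP] Mm e0 xm y My.
have [->|y0] := eqVneq y 0; first by rewrite linear0r !normr0 mulr0.
have ny : 0 < `|y| by rewrite normr_gt0.
rewrite -(@ler_pXn2r _ 2) ?nnegrE ?mulr_ge0// exprMn.
rewrite -ler_pdivrMr ?exprn_gt0//.
have := xm _ (MP (inner (x - m) y / `|y| ^+ 2) _ _ My Mm).
rewrite opprD addrCA addrC sqr_norm_sub_proj//.
by rewrite -addrA lerDl addrC subr_ge0.
Qed.

Lemma natSinv_gt0 n : 0 < (n.+1%:R^-1 : K).
Proof. by rewrite invr_gt0. Qed.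

(* The point [p] is the projection of [x] onto the closure of [M]; it may lie
   outside [M]. *)
Lemma orthogonal_projection (M : set V) x : vector_subspace M ->
  exists (m : nat -> V) (p : V), [/\ forall n, M (m n),
    forall i j, `|m i - m j| <= i.+1%:R^-1 + j.+1%:R^-1,
    m @ \oo --> p & forall y, M y -> inner (x - p) y = 0].
Proof.
move=> Ms; have [M0 MP] := Ms.
(* The tolerance is squared so that the orthogonality defect becomes [1 / (n + 1)]. *)
have ex n : exists m, M m /\ forall y, M y ->
    `|x - m| ^+ 2 <= `|x - y| ^+ 2 + (n.+1%:R^-1) ^+ 2.
  have [|m Mm mx] := @approx_nearest M x ((n.+1%:R^-1) ^+ 2) (ex_intro _ 0 M0).
    by rewrite exprn_gt0// natSinv_gt0.
  by exists m.
have [m mP] := choice ex.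
have Mm n : M (m n) by case: (mP n).
have mo n y : M y -> `|inner (x - m n) y| <= n.+1%:R^-1 * `|y|.
  by case: (mP n) => _ mn My; apply: approx_nearest_orthogonal My => //.
have mC i j : `|m i - m j| <= i.+1%:R^-1 + j.+1%:R^-1.
  have [->|mij] := eqVneq (m i - m j) 0.
    by rewrite normr0 addr_ge0// invr_ge0.
  have Mij : M (m i - m j) by rewrite addrC -scaleN1r; apply: MP.
  have nij : 0 < `|m i - m j| by rewrite normr_gt0.
  (* Both [x - m i] and [x - m j] are almost orthogonal to [m i - m j], which lies in [M]; pairing
     their difference with it and cancelling one norm gives the rate. *)
  rewrite -(ler_pM2r nij) -expr2 -(normr_id (m i - m j)) -normrX -innerxx.
  rewrite (_ : inner (m i - m j) _ =
    inner (x - m j) (m i - m j) - inner (x - m i) (m i - m j)); last first.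
    by rewrite -innerBl opprB [x - _ + _]addrC addrA subrK.
  rewrite (le_trans (ler_normB _ _))// normr_id mulrDl addrC.
  by rewrite lerD// mo.
have [|p mp] := @cvg_of_natSinv_dist 1 m ler01.
  by move=> i j; rewrite mul1r.
exists m, p; split => // y My.
apply: (@eq0_norm_le_eps _ (`|y| + `|y|)) => [|e e0]; first exact: addr_ge0.
have /cvgrPdist_lt/(_ _ e0) pm := mp.
have [n _ /(_ n (leqnn n))[/ltW pn /ltW ne]] :=
  filterI pm (near_natSinv_lt e0).
rewrite (_ : x - p = (x - m n) - (p - m n)); last first.
  by rewrite opprB addrA subrK.
rewrite innerBl (le_trans (ler_normB _ _))// mulrDl lerD//.
  by rewrite (le_trans (mo _ _ My))// mulrC ler_wpM2l.
by rewrite (le_trans (cauchy_schwarz _ _))// mulrC ler_wpM2l.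
Qed.

Lemma riesz_representation (phi : V -> K) (C : K) : 0 <= C ->
  (forall (c : K) u v, phi (c *: u + v) = c * phi u + phi v) ->
  (forall u, `|phi u| <= C * `|u|) ->
  exists w, forall u, phi u = inner u w.
Proof.
move=> C0 phiP phiC.
have phi0 : phi 0 = 0.
  by have := phiP (-1) 0 0; rewrite scaler0 addr0 mulN1r addNr.
have phiZ c u : phi (c *: u) = c * phi u.
  by have := phiP c u 0; rewrite phi0 !addr0.
have phiD u v : phi (u + v) = phi u + phi v.
  by have := phiP 1 u v; rewrite scale1r mul1r.
have phiB u v : phi (u - v) = phi u - phi v.
  by rewrite -scaleN1r phiD phiZ mulN1r.
have [phi_eq0|/existsNP[x x0]] := pselect (forall u, phi u = 0).
  by exists 0 => u; rewrite linear0r.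
have kers : vector_subspace [set u | phi u = 0].
  by split => //= c u v; rewrite phiP => -> ->; rewrite mulr0 addr0.
have [m [p [mk _ mp po]]] := orthogonal_projection x kers.
(* The kernel is closed because [phi] is bounded. *)
have phip : phi p = 0.
  apply: (eq0_norm_le_eps C0) => e e0.
  have /cvgrPdist_lt/(_ _ e0)[n _ /(_ n (leqnn n)) /ltW pn] := mp.
  have -> : phi p = phi (p - m n) by rewrite phiB mk subr0.
  by rewrite (le_trans (phiC _))// ler_wpM2l.
set z := x - p in po.
have phiz : phi z != 0 by rewrite phiB phip subr0; exact/eqP.
have z0 : z != 0 by apply: contra_neq phiz => ->.
have s0 : inner z z != 0 by rewrite innerxx expf_neq0// normr_eq0.
(* The coefficient is forced by the case [u = z]; any [u] differs from a multiple of [z] by an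
   element of the kernel, which is orthogonal to [z]. *)
exists (conj_scalar (phi z / inner z z) *: z) => u.
rewrite innerZr rmorphK.
have : inner z (u - (phi u / phi z) *: z) = 0.
  by apply: po; rewrite /= phiB phiZ divfK// subrr.
move/(congr1 conj_scalar); rewrite rmorph0 -inner_conj innerBl innerZl.
move/eqP; rewrite subr_eq0 => /eqP ->.
have alg (F : fieldType) (a b s : F) : a != 0 -> s != 0 ->
    b = a / s * (b / a * s).
  by move=> a0 s1; field; rewrite a0.
exact: alg.
Qed.

End hilbert_space.

(** * Bounded accretive forms and solvability *)

Section forms.
Variables (R : realType) (k : scalar_kind) (V : hilbertType R k).
Local Notation K := (scalar_field R k).
Variable b : sesquilinear_form R k V.

Let formP c u v w : b (c *: u + v) w = c * b u w + b v w.
Proof. exact: linearPl. Qed.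

Let formPr c u v w : b w (c *: u + v) = conj_scalar c * b w u + b w v.
Proof. exact: linearPr. Qed.

Let formZ c u v : b (c *: u) v = c * b u v.
Proof. exact: linearZl_LR. Qed.

Let formZr c u v : b u (c *: v) = conj_scalar c * b u v.
Proof. exact: linearZr_LR. Qed.

Definition bounded_form (C : K) := forall u v, `|b u v| <= C * (`|u| * `|v|).

Lemma continuous_form_bounded :
  continuous_form b -> exists2 C, 0 <= C & bounded_form C.
Proof.
move=> /(_ (0, 0))/cvgrPdist_lt/(_ _ ltr01)[[/= A B]].
move=> [/nbhs_ballP[d d0 dA] /nbhs_ballP[e e0 eB]] AB.
have small u v : `|u| < d -> `|v| < e -> `|b u v| <= 1.
  move=> ud ve; have := AB (u, v); rewrite /= linear0l sub0r normrN => h.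
  apply/ltW/h; split => /=.
    by apply: dA; rewrite -ball_normE /= sub0r normrN.
  by apply: eB; rewrite -ball_normE /= sub0r normrN.
(* Nonzero [u] and [v] are rescaled to norms [d / 2] and [e / 2], where the form is at most 1. *)
exists (2 / d * (2 / e)) => [|u v]; first by rewrite mulr_ge0// divr_ge0// ltW.
have [->|u0] := eqVneq u 0; first by rewrite linear0l !normr0 mul0r mulr0.
have [->|v0] := eqVneq v 0; first by rewrite linear0r !normr0 !mulr0.
have nu : 0 < `|u| by rewrite normr_gt0.
have nv : 0 < `|v| by rewrite normr_gt0.
have half (W : hilbertType R k) (w : W) (r : K) : 0 < `|w| -> 0 < r ->
    `|(r / 2 / `|w|) *: w| < r /\ 0 < r / 2 / `|w|.
  move=> w0 r0; have p : 0 < r / 2 / `|w| by rewrite !divr_gt0.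
  by rewrite normrZ gtr0_norm// divfK ?gt_eqF// ltr_pdivrMr// ltr_pMr// ltr1n.
have [ud up] := half _ u d nu d0; have [ve vp] := half _ v e nv e0.
have := small _ _ ud ve.
rewrite formZ formZr normrM (gtr0_norm up) normrM norm_conj_scalar.
rewrite (gtr0_norm vp) mulrA -ler_pdivlMl ?mulr_gt0// ?invr_gt0// mulr1.
have alg (F : fieldType) (x y s t : F) :
    (x / 2 / s * (y / 2 / t))^-1 = 2 / x * (2 / y) * (s * t).
  by rewrite !invfM !invrK; ring.
by rewrite alg.
Qed.

Variables (C : K).
Hypotheses (C0 : 0 <= C) (bC : bounded_form C).

(* With [b u v = inner (B u) v], these are the ranges of [B] and of its
   adjoint. *)
Definition range_op := [set w | exists u, forall v, b u v = inner w v].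
Definition range_adj := [set w | exists v, forall u, b u v = inner u w].

Let range_op_subspace : vector_subspace range_op.
Proof.
split; first by exists 0 => v; rewrite !linear0l.
move=> c w w' [u uw] [u' uw']; exists (c *: u + u') => v.
by rewrite formP uw uw' inner_linear.
Qed.

Let range_adj_subspace : vector_subspace range_adj.
Proof.
split; first by exists 0 => v; rewrite !linear0r.
move=> c w w' [u uw] [u' uw']; exists (c *: u + u') => v.
by rewrite formPr uw uw' [RHS]linearPr.
Qed.

Let form_range_adj v : exists2 w, range_adj w & forall u, b u v = inner u w.
Proof.
have [|||w bw] := @riesz_representation _ _ _ (b^~ v) (C * `|v|).
- by rewrite mulr_ge0.
- by move=> c u u'; exact: formP.
- by move=> u; rewrite (le_trans (bC _ _))// mulrAC mulrA.
by exists w => //; exists v.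
Qed.

(** Since [b u] is conjugate-linear, Riesz representation is applied to its conjugate. *)
Let form_range_op u : exists2 w, range_op w & forall v, b u v = inner w v.
Proof.
have [|||w bw] := @riesz_representation _ _ _ (conj_scalar \o b u) (C * `|u|).
- by rewrite mulr_ge0.
- by move=> c v v'; rewrite /= formPr rmorphD rmorphM/= rmorphK.
- by move=> v; rewrite /= norm_conj_scalar (le_trans (bC _ _))// mulrA.
have {}bw v : b u v = inner w v.
  by rewrite inner_conj -bw /= rmorphK.
by exists w => //; exists u.
Qed.

Hypothesis b_accretive : accretive_form b.
Hypothesis b_inj : forall u, (forall v, b u v = 0) -> u = 0.

(** If [z = b f u] were nonzero, adding multiples of [f] to [u] would change [b u u] only by
    multiples of [z], and could make its real part negative. So [b f] vanishes and injectivity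
    applies. *)
Lemma accretive_form_coinjective f : (forall u, b u f = 0) -> f = 0.
Proof.
move=> bf; apply: b_inj => u; apply/eqP/negPn/negP => z0.
set z := b f u in z0; have z2 : 0 < `|z| ^+ 2 by rewrite exprn_gt0// normr_gt0.
(* With this [s], the tested value is [b u u - (|b u u| + 1)], of real part at most -1. *)
pose s := (`|b u u| + 1) / `|z| ^+ 2.
have := b_accretive (- (s * conj_scalar z) *: f + u).
rewrite formP !formPr !bf !mulr0 !add0r -/z.
rewrite mulNr -mulrA [_ * z]mulrC mul_conj_scalar.
rewrite /s divfK ?gt_eqF// => h.
have : 0 <= re_scalar (- (`|b u u| + 1) + `|b u u|).
  by rewrite (le_trans h)// !re_scalarD lerD2l re_scalar_le_norm.
by rewrite opprD addrAC addNr add0r re_scalar_ge0 ?realN1// ler0N1.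
Qed.

Lemma form_bounded_below :
  essentially_coercive b ->
  exists2 c : K, 0 < c &
    forall u w, (forall v, b u v = inner w v) -> c * `|u| <= `|w|.
Proof.
move=> b_coer; apply: contrapT => noc.
have bad n : exists uw : V * V, [/\ `|uw.1| = 1, `|uw.2| <= n.+1%:R^-1 &
    forall v, b uw.1 v = inner uw.2 v].
  apply: contrapT => nobad; apply: noc; exists n.+1%:R^-1.
    exact: natSinv_gt0.
  move=> u w buw; rewrite real_leNgt ?ger0_real ?mulr_ge0 ?invr_ge0//.
  apply/negP => wu; apply: nobad.
  have u0 : 0 < `|u|.
    rewrite lt_neqAle normr_ge0 andbT; apply/eqP => u0.
    by move: wu; rewrite -u0 mulr0 normr_lt0.
  have iu : 0 <= `|u|^-1 by rewrite invr_ge0.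
  exists (`|u|^-1 *: u, `|u|^-1 *: w); split => /=.
  - by rewrite normrZ ger0_norm// mulVf// gt_eqF.
  - by rewrite normrZ ger0_norm// mulrC ler_pdivrMr// ltW.
  - by move=> v; rewrite formZ innerZl buw.
have [uw /all_and3[u1 w0 buw]] := choice bad.
pose u n := (uw n).1; pose w n := (uw n).2.
have weak : weakly_cvg u 0.
  move=> phi phic; rewrite linear0.
  have [D D0 phiD] : exists2 D, 0 <= D & forall x, `|phi x| <= D * `|x|.
    have /linear_boundedP/pinfty_ex_gt0[D D0 phiD] :=
      (linear_bounded_continuous phi).2 phic.
    by exists D; [exact: ltW|].
  have [z phiz] := riesz_representation D0 (linearP phi) phiD.
  have [m [p [mr _ mp po]]] := orthogonal_projection z range_adj_subspace.
  (* Injectivity of [b] makes the range of the adjoint dense: [z - p] is orthogonal to every vector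
     representing some [b^~ v]. *)
  have zp : z = p.
    apply/eqP; rewrite -subr_eq0; apply/eqP/b_inj => v.
    by have [y ry ->] := form_range_adj v; exact: po.
  apply: (@cvg0_norm_le_eps _ 2) => // e e0.
  have /cvgrPdist_lt/(_ _ e0)[i _ /(_ i (leqnn i)) /ltW pi] := mp.
  have [v bv] := mr i.
  have e1 : 0 < e / (`|v| + 1) by rewrite divr_gt0// ltr_wpDl.
  have := near_natSinv_lt e1; apply: filterS => n /ltW ne.
  (* The term with [p - m i] is small because [u n] has norm 1; the term with [m i] equals
     [b (u n) v], which is small because [w n] tends to 0. *)
  rewrite phiz zp (_ : p = (p - m i) + m i); last by rewrite subrK.
  rewrite linearDr/= mulr_natl mulr2n (le_trans (ler_normD _ _))// lerD//.
    by rewrite (le_trans (cauchy_schwarz _ _))// u1 mul1r.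
  rewrite -bv buw (le_trans (cauchy_schwarz _ _))//.
  rewrite (@le_trans _ _ (e / (`|v| + 1) * (`|v| + 1)))//.
    by rewrite ler_pM// ?(le_trans (w0 n))// lerDl.
  by rewrite divfK// gt_eqF// ltr_wpDl.
have form0 : (b (u n) (u n) : K^o) @[n --> \oo] --> (0 : K^o).
  apply: (@cvg0_norm_le_eps _ 1) => // e e0; rewrite mul1r.
  have := near_natSinv_lt e0; apply: filterS => n /ltW ne.
  by rewrite buw (le_trans (cauchy_schwarz _ _))// u1 mulr1 (le_trans (w0 n)).
have /cvgr0Pnorm_lt/(_ _ ltr01)[n _ /(_ n (leqnn n))] := b_coer u weak form0.
by rewrite /u u1 normr1 ltxx.
Qed.

(** Coinjectivity makes the range of [B] dense, so [f] is a limit of vectors [B (u n)]. The lower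
    bound carries their Cauchy rate over to [u n], and boundedness of [b] passes the equation to the
    limit. *)
Lemma essentially_coercive_surjective f : essentially_coercive b ->
  exists u, forall v, b u v = inner f v.
Proof.
move=> /form_bounded_below[c c0 cb].
have [m [p [mr mC mp po]]] := orthogonal_projection f range_op_subspace.
have fp : f = p.
  apply/eqP; rewrite -subr_eq0; apply/eqP/accretive_form_coinjective => u.
  have [w rw ->] := form_range_op u.
  by rewrite inner_conj po// rmorph0.
have [u um] := choice mr.
have [||l ul] := @cvg_of_natSinv_dist _ _ _ c^-1 u.
- by rewrite invr_ge0 ltW.
- move=> i j; rewrite ler_pdivlMl// (le_trans _ (mC i j))//; apply: cb => v.
  by rewrite linearBl/= !um innerBl.
exists l => v; apply/eqP; rewrite -subr_eq0; apply/eqP.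
apply: (@eq0_norm_le_eps _ (C * `|v| + `|v|)) => [|e e0].
  by rewrite addr_ge0// mulr_ge0.
have /cvgrPdist_lt/(_ _ e0) le := ul; have /cvgrPdist_lt/(_ _ e0) pe := mp.
have [n _ /(_ n (leqnn n))[/ltW ln /ltW pn]] := filterI le pe.
rewrite (_ : _ - _ = b (l - u n) v - inner (p - m n) v); last first.
  by rewrite linearBl/= innerBl um fp opprB addrA subrK.
rewrite (le_trans (ler_normB _ _))// mulrDl lerD//.
  by rewrite (le_trans (bC _ _))// -mulrA ler_wpM2l// mulrC ler_wpM2l.
by rewrite (le_trans (cauchy_schwarz _ _))// mulrC ler_wpM2l.
Qed.

End forms.

(** * The form of [Id + A] *)

Section shift.
Variables (R : realType) (k : scalar_kind) (V H : hilbertType R k).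
Local Notation K := (scalar_field R k).
Variables (j : {linear V -> H}) (a : sesquilinear_form R k V).

(** This is [shifted_form a j (-1)], the form that corresponds to [Id + A]. *)
Definition resolvent_form (u v : V) : K := a u v + inner (j u) (j v).

Let resolvent_form_bilinear :
  bilinear_for (GRing.Scale.Law.clone _ _ *%R _)
    (GRing.Scale.Law.clone _ _ (@conj_scalar R k \; *%R) _) resolvent_form.
Proof.
rewrite /resolvent_form; split => [w c u v|w c u v] /=.
  by rewrite linearPl linearP inner_linear /= mulrDr addrACA.
by rewrite linearPr linearP [X in _ + X = _]linearPr /= mulrDr addrACA.
Qed.

HB.instance Definition _ :=
  bilinear_isBilinear.Build _ _ _ _ _ _ resolvent_form resolvent_form_bilinear.

Hypothesis a_accretive : accretive_form a.

Lemma re_resolvent_form u :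
  re_scalar (resolvent_form u u) = re_scalar (a u u) + re_scalar (`|j u| ^+ 2).
Proof. by rewrite -innerxx -re_scalarD. Qed.

Lemma resolvent_form_accretive : accretive_form resolvent_form.
Proof.
move=> u; rewrite re_resolvent_form addr_ge0//.
by rewrite re_scalar_ge0 ?ger0_real// exprn_ge0.
Qed.

Lemma sqr_norm_le_resolvent_form u : `|j u| ^+ 2 <= `|resolvent_form u u|.
Proof.
rewrite -ler_re_scalar ?ger0_real ?exprn_ge0//.
rewrite (le_trans _ (re_scalar_le_norm _))// re_resolvent_form lerDr.
exact: a_accretive.
Qed.

(** Testing with [v = u] forces [j u = 0]; the form then reduces to [a u], and nondegeneracy
    applies. *)
Lemma resolvent_form_injective : nondegenerate_on_kernel a j ->
  forall u, (forall v, resolvent_form u v = 0) -> u = 0.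
Proof.
move=> nd u u0; have ju : j u = 0.
  apply/eqP; rewrite -normr_eq0 -sqrf_eq0 -normr_le0 ger0_norm ?exprn_ge0//.
  by rewrite (le_trans (sqr_norm_le_resolvent_form u))// u0 normr0.
apply: nd => // v _; have := u0 v.
by rewrite /resolvent_form ju linear0l addr0.
Qed.

(** The two forms differ on the diagonal by [(1 + lambda) * |j u|^2], which the resolvent form
    itself dominates, so the shifted form also tends to 0 along the sequence. *)
Lemma resolvent_form_essentially_coercive lambda :
  essentially_coercive (shifted_form a j lambda) ->
  essentially_coercive resolvent_form.
Proof.
move=> coer u u0 bu0; apply: coer => //.
apply: (@cvg0_norm_le_eps _ (1 + `|1 + lambda|)) => [|e e0].
  by rewrite addr_ge0.
have /cvgr0Pnorm_le/(_ _ e0) := bu0; apply: filterS => n bn.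
rewrite (_ : shifted_form _ _ _ _ _ =
    resolvent_form (u n) (u n) - (1 + lambda) * `|j (u n)| ^+ 2); last first.
  rewrite /shifted_form /resolvent_form innerxx mulrDl mul1r opprD addrA.
  by rewrite addrK.
rewrite (le_trans (ler_normB _ _))// [leRHS]mulrDl mul1r lerD//.
rewrite normrM ler_wpM2l// ger0_norm ?exprn_ge0//.
exact: le_trans (sqr_norm_le_resolvent_form _) bn.
Qed.

End shift.

(** * From the form back to the operator *)

Lemma bounded_operatorP (R : realType) (k : scalar_kind) (V H : hilbertType R k)
    (j : V -> H) : bounded_operator j ->
  exists2 M, 0 <= M & forall u, `|j u| <= M * `|u|.
Proof.
(* If [V] is trivial, [M] can be any scalar, even negative or nonreal; its modulus is a safe
   bound. *)
move=> [M jM]; exists `|M| => // u.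
have Mu : 0 <= M * `|u| by rewrite (le_trans _ (jM u)).
by rewrite -[`|u|]normr_id -normrM ger0_norm.
Qed.

Theorem theorem3p4 (R : realType) (k : scalar_kind) (V H : hilbertType R k)
    (j : {linear V -> H}) (a : sesquilinear_form R k V) (A : operator H)
    (j_bounded : bounded_operator j)
    (j_dense : dense (range j))
    (a_continuous : continuous_form a)
    (a_nondegenerate : nondegenerate_on_kernel a j)
    (A_associated : is_associated_operator a j A)
    (a_accretive : accretive_form a)
    (a_coercive : exists lambda : scalar_field R k,
      essentially_coercive (shifted_form a j lambda)) :
  m_accretive A.
Proof.
have AE x f : graph A (x, f) <-> associated_graph a j (x, f).
  by rewrite A_associated.
split=> [x Dx|f].
  have /AE[u [/= <- au]] : graph A (x, A x) by [].
  by rewrite -au.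
have [C C0 aC] := continuous_form_bounded a_continuous.
have [M M0 jM] := bounded_operatorP j_bounded.
have [lambda coer] := a_coercive.
(* Here [w] is the adjoint of [j] applied to [f], which turns the right-hand side into a vector of
   [V]. *)
have [w wf] : exists w, forall v, inner (j v) f = inner v w.
  apply: (@riesz_representation _ _ _ _ (M * `|f|)); first exact: mulr_ge0.
    by move=> c u v; rewrite linearP inner_linear.
  move=> u; rewrite (le_trans (cauchy_schwarz _ _))// mulrAC.
  by rewrite ler_wpM2r.
have bC : bounded_form (resolvent_form j a) (C + M * M).
  move=> u v; rewrite (le_trans (ler_normD _ _))// mulrDl lerD//.
  rewrite (le_trans (cauchy_schwarz _ _))// mulrACA.
  by rewrite ler_pM.
have CM0 : 0 <= C + M * M by rewrite addr_ge0// mulr_ge0.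
have [u uw] := essentially_coercive_surjective CM0 bC
  (resolvent_form_accretive j a_accretive)
  (resolvent_form_injective a_accretive a_nondegenerate) w
  (resolvent_form_essentially_coercive a_accretive coer).
(* Moving [inner (j u) (j v)] to the right-hand side shows [A (j u) = f - j u]. *)
have /AE[/= Dju Aju] : associated_graph a j (j u, f - j u).
  exists u; split => //= v; have := uw v.
  rewrite /resolvent_form innerBl [inner f _]inner_conj wf -inner_conj => <-.
  by rewrite addrK.
by exists (j u) => //; rewrite Aju addrC subrK.
Qed.
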